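(* Suppose $K<m$, let $(\mathbf x^*,s^*,\hat{\boldsymbol\lambda}^*,\mathbf q^*,\mathbf Q^* )$ be any optimal solution of the problem (SDP) defined in the context, and let $S_k=s^*-y_k^0(\mathbf x^* )-\boldsymbol\lambda_k^{*\top}\mathbf b-y_k(\mathbf x^* )^\top\boldsymbol\mu+\boldsymbol\lambda_k^{*\top}\mathbf A\boldsymbol\mu$ for $k\in[K]$. Then there exists an optimal solution $(\mathbf x^*,s^*,\hat{\boldsymbol\lambda}^*,\mathbf q',\mathbf Q')$ of (SDP) (with the same $\mathbf x^*,s^*,\hat{\boldsymbol\lambda}^*$) such that $$\operatorname{rank}(\mathbf Q')\le K,\qquad \mathbf q'=\mathbf V\boldsymbol\delta,\qquad \mathbf Q'=\mathbf V\mathbf Y_{11}\mathbf V^\top,$$ $$\left(\mathbf U\boldsymbol\Lambda^{1/2}\right)^\top\left(\mathbf A^\top\boldsymbol\lambda_k^*-y_k(\mathbf x^* )\right)=\mathbf V\boldsymbol\nu_k\quad\text{for all }k\in[K],$$ for some $\mathbf Y_{11}\in\mathbb R^{K\times K}$ with $\mathbf Y_{11}\succeq0$, some $\mathbf V=[\mathbf v_1,\dots,\mathbf v_K]\in\mathbb R^{m\times K}$ with orthonormal columns $\mathbf v_k\in\mathbb R^m$, some $\boldsymbol\delta\in\mathbb R^K$, and some $\boldsymbol\nu_k\in\mathbb R^K$, $k\in[K]$.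
   Context: Setting. $[N]=\{1,\dots,N\}$; $m,n,l,K$ are positive integers; $\gamma_1\ge 0$, $\gamma_2\ge 1$; $\boldsymbol\mu\in\mathbb R^m$; $\boldsymbol\Sigma\in\mathbb R^{m\times m}$ is symmetric positive definite with eigenvalue decomposition $\boldsymbol\Sigma=\mathbf U\boldsymbol\Lambda\mathbf U^\top$, $\mathbf U$ orthogonal, $\boldsymbol\Lambda$ diagonal with nonincreasing diagonal entries. $\mathcal X\subseteq\mathbb R^n$. $\mathbf A\in\mathbb R^{l\times m}$ and $\mathbf b\in\mathbb R^l$ are such that $\{\boldsymbol\xi\in\mathbb R^m:\mathbf A\boldsymbol\xi\le\mathbf b\}$ has at least one interior point. For $k\in[K]$, $y_k^0(\mathbf x)\in\mathbb R$ and $y_k(\mathbf x)\in\mathbb R^m$ are affine in $\mathbf x\in\mathbb R^n$. $\mathbf M\succeq0$ means $\mathbf M$ is (symmetric) positive semidefinite; $\mathbf A\bullet\mathbf B=\sum_{i,j}A_{ij}B_{ij}$. Problem (SDP): minimize $$s+\gamma_2\,\mathbf I_m\bullet\mathbf Q+\sqrt{\gamma_1}\,\|\mathbf q\|_2$$ over $\mathbf x\in\mathcal X$, $s\in\mathbb R$, $\hat{\boldsymbol\lambda}=\{\boldsymbol\lambda_1,\dots,\boldsymbol\lambda_K\}$ with $\boldsymbol\lambda_k\in\mathbb R^l_+$, $\mathbf q\in\mathbb R^m$, $\mathbf Q\in\mathbb R^{m\times m}$, subject to, for all $k\in[K]$, $$\begin{bmatrix} s-y_k^0(\mathbf x)-\boldsymbol\lambda_k^\top\mathbf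 b-y_k(\mathbf x)^\top\boldsymbol\mu+\boldsymbol\lambda_k^\top\mathbf A\boldsymbol\mu & \frac12\left(\mathbf q+(\mathbf U\boldsymbol\Lambda^{1/2})^\top(\mathbf A^\top\boldsymbol\lambda_k-y_k(\mathbf x))\right)^\top\\ \frac12\left(\mathbf q+(\mathbf U\boldsymbol\Lambda^{1/2})^\top(\mathbf A^\top\boldsymbol\lambda_k-y_k(\mathbf x))\right)&\mathbf Q\end{bmatrix}\succeq0 .$$ *)

(* Defs.v *)
From HB Require Import structures.
From mathcomp Require Import all_boot all_order all_algebra.
From mathcomp Require Import classical_sets reals topology normedtype.

Set Implicit Arguments.
Unset Strict Implicit.
Unset Printing Implicit Defensive.

Import Order.TTheory GRing.Theory Num.Theory.
Import numFieldNormedType.Exports.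
Local Open Scope ring_scope.
Local Open Scope classical_set_scope.

Definition affine_map (R : nzRingType) (E F : lmodType R) (f : E -> F) : Prop :=
  exists (L : {linear E -> F}) (c : F), forall x, f x = L x + c.

Section Matrices.
Context {R : realType}.

Definition inner p (u v : 'cV[R]_p) : R := \sum_i u i 0 * v i 0.

Definition norm2 p (u : 'cV[R]_p) : R := Num.sqrt (\sum_i u i 0 ^+ 2).

(* Symmetry is part of (semi)definiteness here; for psdmx this is what forces
   the free variable Q of the semidefinite program to be symmetric. *)
Definition posdefmx p (M : 'M[R]_p) : Prop :=
  M^T = M /\ forall v : 'cV[R]_p, v != 0 -> 0 < (v^T *m M *m v) 0 0.

Definition psdmx p (M : 'M[R]_p) : Prop :=
  M^T = M /\ forall v : 'cV[R]_p, 0 <= (v^T *m M *m v) 0 0.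

Definition mxdot p r (M N : 'M[R]_(p, r)) : R := \sum_i \sum_j M i j * N i j.

Definition polyhedron p r (A : 'M[R]_(r, p)) (b : 'cV[R]_r) : set 'cV[R]_p :=
  [set xi | forall i, (A *m xi) i 0 <= b i 0].

(* U Lambda^(1/2), where Lambda = diag_mx d and the square root is entrywise. *)
Definition factor_mx p (U : 'M[R]_p) (d : 'rV[R]_p) : 'M[R]_p :=
  U *m diag_mx (map_mx Num.sqrt d).

End Matrices.

(* Decision variables (x, s, (lambda_k)_k, q, Q), with no constraint imposed. *)
Record sdp_point (R : realType) (m n l K : nat) := SdpPoint {
  sdp_x : 'cV[R]_n;
  sdp_s : R;
  sdp_lam : 'I_K -> 'cV[R]_l;
  sdp_q : 'cV[R]_m;
  sdp_Q : 'M[R]_m }.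

Section SDP.
Context {R : realType} {m n l K : nat}.
Variables (gamma1 gamma2 : R) (mu : 'cV[R]_m).
Variables (U : 'M[R]_m) (d : 'rV[R]_m).
Variable X : set 'cV[R]_n.
Variables (A : 'M[R]_(l, m)) (b : 'cV[R]_l).
Variables (y0 : 'I_K -> 'cV[R]_n -> R) (y : 'I_K -> 'cV[R]_n -> 'cV[R]_m).

Implicit Type z : sdp_point R m n l K.

(* The upper-left entry of the k-th block; it does not depend on q and Q. *)
Definition sdp_S z (k : 'I_K) : R :=
  sdp_s z - y0 k (sdp_x z) - inner (sdp_lam z k) b
  - inner (y k (sdp_x z)) mu + inner (sdp_lam z k) (A *m mu).

Definition sdp_w z (k : 'I_K) : 'cV[R]_m :=
  (factor_mx U d)^T *m (A^T *m sdp_lam z k - y k (sdp_x z)).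

Definition sdp_block z (k : 'I_K) : 'M[R]_(1 + m) :=
  let h := 2^-1 *: (sdp_q z + sdp_w z k) in
  block_mx (sdp_S z k)%:M h^T h (sdp_Q z).

Definition sdp_feasible z : Prop :=
  [/\ X (sdp_x z),
      forall k i, 0 <= sdp_lam z k i 0 &
      forall k, psdmx (sdp_block z k)].

Definition sdp_objective z : R :=
  sdp_s z + gamma2 * mxdot 1%:M (sdp_Q z) + Num.sqrt gamma1 * norm2 (sdp_q z).

Definition sdp_optimal z : Prop :=
  sdp_feasible z /\
  forall z', sdp_feasible z' -> sdp_objective z <= sdp_objective z'.

End SDP.

(* Main.v *)
Require Import Defs.
From mathcomp Require Import all_boot all_order all_algebra.
From mathcomp Require Import classical_sets reals topology normedtype.
Import Order.TTheory GRing.Theory Num.Theory.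
Import numFieldNormedType.Exports.
Local Open Scope ring_scope.
Local Open Scope classical_set_scope.

(** Let [w_k] denote the vector [(U Lambda^(1/2))^T (A^T lambda_k - y_k(x))].
    Once [x], [s] and the [lambda_k] are held at their optimal values, the
    remaining variables [q] and [Q] meet the problem data only through the [K]
    vectors [w_k].  Since [K < m], some [V] with [K] orthonormal columns has all
    the [w_k] in its column space ([orthonormal_cover]).  Let [P = V V^T] be the
    orthogonal projector onto that space, and replace [(q, Q)] by
    [(P q, P Q P)].

    Feasibility survives because [P w_k = w_k]: the new k-th block is the
    congruence of the old one by [diag(1, P)] ([sdp_block_proj]), and
    congruence preserves positive semidefiniteness ([psdmx_congr]).  The
    objective does not increase because a projector shrinks the Euclidean norm
    ([norm2_proj]) and shrinks the trace of a positive semidefinite matrix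
    ([mxtrace_proj]).  So the projected point is again optimal, and the
    required factorizations are read off from [P = V V^T], with
    [Y11 = V^T Q V], [delta = V^T q] and [nu_k = V^T w_k]. *)

Section EuclideanMatrices.
Set Implicit Arguments.
Unset Strict Implicit.
Context {R : realType}.

Lemma col_sqrE p (u : 'cV[R]_p) : (u^T *m u) 0 0 = \sum_i u i 0 ^+ 2.
Proof. by rewrite mxE; apply: eq_bigr => i _; rewrite mxE expr2. Qed.

Lemma col_sqr_ge0 p (u : 'cV[R]_p) : 0 <= (u^T *m u) 0 0.
Proof. by rewrite col_sqrE sumr_ge0 // => i _; rewrite sqr_ge0. Qed.

Lemma col_sqr_gt0 p (u : 'cV[R]_p) : u != 0 -> 0 < (u^T *m u) 0 0.
Proof.
move=> u0; rewrite lt_def col_sqr_ge0 andbT; apply: contraNneq u0.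
rewrite col_sqrE => /eqP; rewrite psumr_eq0 => [/allP u0|i _]; last first.
  exact: sqr_ge0.
apply/eqP/colP => i; rewrite mxE; apply/eqP.
by rewrite -sqrf_eq0; apply: u0; rewrite mem_index_enum.
Qed.

Lemma exists_orthogonal_col p k (V : 'M[R]_(p, k)) :
  (k < p)%N -> exists2 u : 'cV[R]_p, u != 0 & V^T *m u = 0.
Proof.
move=> kp; exists (nz_row (kermx V))^T.
  rewrite -trmx0 (inj_eq trmx_inj) nz_row_eq0 -mxrank_eq0 mxrank_ker -lt0n.
  by rewrite subn_gt0 (leq_ltn_trans (rank_leq_col V)).
rewrite -trmx_mul; apply/eqP; rewrite -trmx0 (inj_eq trmx_inj).
by apply/eqP/sub_kermxP; exact: nz_row_sub.
Qed.

(** Gram-Schmidt, one column of [W] at a time.  When the new column already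
    lies in the span of the previous ones its residual [r] vanishes and cannot
    be normalized; any vector orthogonal to the previous columns then serves,
    and [k <= p] leaves room for one. *)
Lemma orthonormal_cover p k (W : 'M[R]_(p, k)) : (k <= p)%N ->
  exists2 V : 'M[R]_(p, k), V^T *m V = 1%:M & V *m V^T *m W = W.
Proof.
elim: k W => [|k IHk].
  by move=> W _; exists 0; [apply/matrixP => -[] | apply/matrixP => i []].
rewrite -[k.+1]/(1 + k)%N => W kp; rewrite -[W]hsubmxK.
set w := lsubmx _; set W' := rsubmx _.
have [V VV VW] := IHk W' (ltnW kp).
pose r := w - V *m (V^T *m w).
have Vr : V^T *m r = 0 by rewrite /r mulmxBr (mulmxA V^T) VV mul1mx subrr.
have [u [u0 Vu [c rE]]] : exists u : 'cV[R]_p,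
    [/\ u != 0, V^T *m u = 0 & exists c, r = c *: u].
  have [r0|r0] := eqVneq r 0; last first.
    by exists r; split => //; exists 1; rewrite scale1r.
  have [u u0 Vu] := exists_orthogonal_col V kp.
  by exists u; split => //; exists 0; rewrite r0 scale0r.
pose t := Num.sqrt ((u^T *m u) 0 0).
have t0 : t != 0 by rewrite gt_eqF // sqrtr_gt0 col_sqr_gt0.
have uu : u^T *m u = (t ^+ 2)%:M.
  by rewrite sqr_sqrtr ?col_sqr_ge0 // [LHS]mx11_scalar.
pose v := t^-1 *: u.
have vv : v^T *m v = 1%:M.
  rewrite /v [(_ *: u)^T]linearZ -scalemxAr -scalemxAl uu !scale_scalar_mx.
  by congr (_%:M); rewrite expr2 mulKf // mulVf.
have Vv : V^T *m v = 0 by rewrite /v -scalemxAr Vu scaler0.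
have vV : v^T *m V = 0 by rewrite -[V]trmxK -trmx_mul Vv trmx0.
exists (row_mx v V).
  rewrite tr_row_mx mul_col_row vv Vv vV VV.
  exact/esym/scalar_mx_block.
have vW' : v^T *m W' = 0 by rewrite -VW !mulmxA vV !mul0mx.
have wE : w = (t * c) *: v + V *m (V^T *m w).
  rewrite /v scalerA mulrAC divff // mul1r -rE /r subrK //.
have vw : v^T *m w = (t * c)%:M.
  by rewrite wE mulmxDr -scalemxAr vv (mulmxA _ V) vV mul0mx addr0
    scale_scalar_mx mulr1.
rewrite tr_row_mx mul_row_col mul_mx_row; congr row_mx.
  by rewrite mulmxDl -!mulmxA vw [RHS]wE mul_mx_scalar.
by rewrite mulmxDl VW -mulmxA vW' mulmx0 add0r.
Qed.

Lemma psdmx_congr p r (M : 'M[R]_p) (B : 'M[R]_(p, r)) :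
  psdmx M -> psdmx (B^T *m M *m B).
Proof.
move=> [Ms Mp]; split; first by rewrite !trmx_mul trmxK Ms mulmxA.
by move=> v; have := Mp (B *m v); rewrite trmx_mul !mulmxA.
Qed.

Lemma psdmx_drblock p r (a : 'M[R]_p) b c (Q : 'M[R]_r) :
  psdmx (block_mx a b c Q) -> psdmx Q.
Proof.
move=> /(@psdmx_congr _ _ _ (col_mx 0 1%:M)).
by rewrite tr_col_mx trmx0 trmx1 mul_row_block mul_row_col !mul0mx
  mulmx0 !mul1mx !add0r mulmx1.
Qed.

Lemma psdmx_mxtrace_ge0 p (M : 'M[R]_p) : psdmx M -> 0 <= \tr M.
Proof.
move=> [_ Mp]; apply: sumr_ge0 => i _; have := Mp (delta_mx i 0).
by rewrite trmx_delta -rowE -colE !mxE.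
Qed.

Lemma mxdot1 p (M : 'M[R]_p) : mxdot 1%:M M = \tr M.
Proof.
apply: eq_bigr => i _; rewrite (bigD1 i) //= big1 => [|j ij].
  by rewrite mxE eqxx mul1r addr0.
by rewrite mxE eq_sym (negPf ij) mul0r.
Qed.

Section Projector.
Variables (p : nat) (P : 'M[R]_p).
Hypotheses (PT : P^T = P) (PP : P *m P = P).

Let compl_tr : (1%:M - P)^T = 1%:M - P.
Proof. by rewrite linearB /= trmx1 PT. Qed.

Let compl_idem : (1%:M - P) *m (1%:M - P) = 1%:M - P.
Proof. by rewrite mulmxBl mul1mx mulmxBr mulmx1 PP subrr subr0. Qed.

(** Pythagoras: the squared norms of [P u] and [(1 - P) u] add up to that
    of [u]. *)
Lemma norm2_proj (u : 'cV[R]_p) : norm2 (P *m u) <= norm2 u.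
Proof.
rewrite /norm2 ler_wsqrtr // -!col_sqrE -subr_ge0.
have := col_sqr_ge0 ((1%:M - P) *m u).
rewrite !trmx_mul compl_tr PT !mulmxA -(mulmxA _ _ (1%:M - P)) compl_idem.
by rewrite -(mulmxA _ P P) PP mulmxBr mulmx1 mulmxBl !mxE.
Qed.

(** By cyclicity the traces of [P Q P] and [(1 - P) Q (1 - P)] are those of
    [Q P] and [Q (1 - P)], so they add up to that of [Q]; and the second one is
    nonnegative. *)
Lemma mxtrace_proj (Q : 'M[R]_p) : psdmx Q -> \tr (P *m Q *m P) <= \tr Q.
Proof.
move=> /(psdmx_congr (1%:M - P))/psdmx_mxtrace_ge0.
rewrite compl_tr mxtrace_mulC mulmxA compl_idem.
rewrite [in X in _ -> X]mxtrace_mulC mulmxA PP.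
by rewrite mulmxBl mul1mx linearB /= subr_ge0.
Qed.

End Projector.

(** Why projecting [q] and [Q] keeps the linear matrix inequality: [P] fixes [w],
    so projecting [q] alone already projects the off-diagonal block, and the
    result is a congruence by [diag(1, P)]. *)
Lemma sdp_block_proj p (P : 'M[R]_p) (s : R) (q w : 'cV[R]_p) (Q : 'M[R]_p) :
  P^T = P -> P *m w = w ->
  let h := 2^-1 *: (q + w) in let h' := 2^-1 *: (P *m q + w) in
  let D := block_mx 1%:M 0 0 P : 'M_(1 + p) in
  block_mx s%:M h'^T h' (P *m Q *m P) =
  D^T *m block_mx s%:M h^T h Q *m D.
Proof.
move=> PT Pw h h' D.
have -> : h' = P *m h by rewrite /h -scalemxAr mulmxDr Pw.
rewrite /D tr_block_mx trmx1 !trmx0 PT !mulmx_block trmx_mul PT.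
by rewrite !mul0mx !mulmx0 !mul1mx !mulmx1 !addr0 !add0r.
Qed.

End EuclideanMatrices.

Theorem theorem2 (R : realType) (m n l K : nat)
  (hm : (0 < m)%N) (hn : (0 < n)%N) (hl : (0 < l)%N) (hK : (0 < K)%N)
  (gamma1 gamma2 : R) (hgamma1 : 0 <= gamma1) (hgamma2 : 1 <= gamma2)
  (mu : 'cV[R]_m) (Sigma : 'M[R]_m) (hSigma : posdefmx Sigma)
  (U : 'M[R]_m) (d : 'rV[R]_m)
  (hU : U^T *m U = 1%:M)
  (hd : forall i j : 'I_m, (i <= j)%N -> d 0 j <= d 0 i)
  (hdecomp : Sigma = U *m diag_mx d *m U^T)
  (X : set 'cV[R]_n)
  (A : 'M[R]_(l, m)) (b : 'cV[R]_l)
  (hAb : interior (polyhedron A b) !=set0)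
  (y0 : 'I_K -> 'cV[R]_n -> R) (y : 'I_K -> 'cV[R]_n -> 'cV[R]_m)
  (hy0 : forall k, affine_map (y0 k : 'cV[R]_n -> R^o))
  (hy : forall k, affine_map (y k))
  (hKm : (K < m)%N)
  (z : sdp_point R m n l K)
  (hz : sdp_optimal gamma1 gamma2 mu U d X A b y0 y z) :
  exists (q' : 'cV[R]_m) (Q' : 'M[R]_m),
    sdp_optimal gamma1 gamma2 mu U d X A b y0 y
      (SdpPoint (sdp_x z) (sdp_s z) (sdp_lam z) q' Q') /\
    (\rank Q' <= K)%N /\
    exists (Y11 : 'M[R]_K) (V : 'M[R]_(m, K)) (delta : 'cV[R]_K)
           (nu : 'I_K -> 'cV[R]_K),
      psdmx Y11 /\
      V^T *m V = 1%:M /\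
      q' = V *m delta /\
      Q' = V *m Y11 *m V^T /\
      forall k : 'I_K,
        (factor_mx U d)^T *m (A^T *m sdp_lam z k - y k (sdp_x z))
          = V *m nu k.
Proof.
have [[zX zlam zpsd] zmin] := hz.
pose w := sdp_w U d A y z.
have [V VV VW] := orthonormal_cover (\matrix_(i, k) w k i 0) (ltnW hKm).
set P := V *m V^T in VW.
have Pw k : P *m w k = w k.
  have wE : col k (\matrix_(i, j) w j i 0) = w k.
    by apply/colP => i; rewrite !mxE.
  by rewrite -wE colE mulmxA VW.
have PT : P^T = P by rewrite /P trmx_mul trmxK.
have PP : P *m P = P by rewrite /P mulmxA -(mulmxA V) VV mulmx1.
(* [K > 0] guarantees that some constraint forces [Q] to be semidefinite. *)
have Qpsd : psdmx (sdp_Q z) := psdmx_drblock (zpsd (Ordinal hK)).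
have QE : P *m sdp_Q z *m P = V *m (V^T *m sdp_Q z *m V) *m V^T.
  by rewrite /P !mulmxA.
exists (P *m sdp_q z), (P *m sdp_Q z *m P); split; [split|split].
- split=> //= k; rewrite /sdp_block /=.
  rewrite (sdp_block_proj _ _ _ PT (Pw k)).
  exact/psdmx_congr/zpsd.
- move=> z' /zmin; apply: le_trans.
  rewrite /sdp_objective /= !mxdot1 lerD //.
    rewrite lerD2l ler_wpM2l ?mxtrace_proj //.
    by rewrite (le_trans ler01).
  by rewrite ler_wpM2l ?sqrtr_ge0 ?norm2_proj.
- by rewrite QE -mulmxA (leq_trans (mxrankM_maxl _ _)) ?rank_leq_col.
exists (V^T *m sdp_Q z *m V), V, (V^T *m sdp_q z), (fun k => V^T *m w k).
split; first exact: psdmx_congr.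
by do !split=> //; [rewrite mulmxA | move=> k; rewrite mulmxA Pw].
Qed.
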